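(* Fix an integer $d\ge 1$. Every constant-query testable $d$-bounded graph property $\Pi$ is either finite or contains an infinite hyperfinite subproperty. Moreover, if $\Pi$ is a non-trivially constant-query testable $d$-bounded graph property, then its complement $\overline{\Pi}$ contains an infinite hyperfinite subproperty.
   Context: A graph is $d$-bounded if its maximum degree is at most $d$ (a constant). A ($d$-bounded) graph property is a set of ($d$-bounded) graphs closed under isomorphism; $\Pi_n$ denotes the set of $n$-vertex graphs in $\Pi$. A subproperty of $\Pi$ is a subset of $\Pi$ that is itself closed under isomorphism. The complement $\overline{\Pi}$ is the set of all $d$-bounded graphs not in $\Pi$. An $n$-vertex $d$-bounded graph is $\varepsilon$-far from $\Pi_n$ if more than $\varepsilon d n$ edge modifications (insertions/deletions) are needed to turn it into a graph in $\Pi_n$. A tester for $\Pi$ receives $\varepsilon\in(0,1]$, $n$, $d$ and query access to the adjacency lists of an $n$-vertex $d$-bounded graph $G$ (a query $(u,i)$ with $i\le d$ returns the $i$-th neighbor of $u$ or a special symbol if none), and with probability at least $2/3$ accepts $G$ if $G\in\Pi_n$ and rejects $G$ if $G$ is $\varepsilon$-far from $\Pi_n$. $\Pi$ is (constant-query) testable if it has a tester making at most $q(\varepsilon,d)$ queries for some function $q$ depending only on $\varepsilon,d$. $\Pi$ is non-trivially testable if it is testable and there exists $\varepsilon>0$ such that the set of graphs that are $\varepsilon$-far from $\Pi$ (i.e. $n$-vertex graphs $\varepsilon$-far from $\Pi_n$, over all $n$) is infinite. A $d$-bounded graph $G$ is $(\varepsilon,k)$-hyperfinite if one can remove at most $\varepsilon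 d|V(G)|$ edges so that every connected component of the resulting graph has at most $k$ vertices; for $\rho:\mathbb{R}^+\to\mathbb{N}^+$, $G$ is $\rho$-hyperfinite if it is $(\varepsilon,\rho(\varepsilon))$-hyperfinite for every $\varepsilon>0$; a set of graphs is hyperfinite if there is a single function $\rho$ such that every graph in it is $\rho$-hyperfinite. *)

(* Defs.v *)
From HB Require Import structures.
From mathcomp Require Import all_boot all_order all_algebra.
From mathcomp Require Import boolp classical_sets functions cardinality reals.

Set Implicit Arguments.
Unset Strict Implicit.
Unset Printing Implicit Defensive.

Import Order.TTheory GRing.Theory Num.Theory.

Local Open Scope ring_scope.
Local Open Scope classical_set_scope.

Definition edge_adj (n : nat) (E : {set {set 'I_n}}) : rel 'I_n :=
  fun u v => [set u; v]%SET \in E.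

Record sgraph (n : nat) := SGraph {
  edges : {set {set 'I_n}};
  edges_card2 : [forall e in edges, #|e| == 2%N] }.

HB.instance Definition _ (n : nat) := [isSub for @edges n].
HB.instance Definition _ (n : nat) := [Finite of sgraph n by <:].

(* Irreflexive because every edge has two elements. *)
Definition adj (n : nat) (G : sgraph n) : rel 'I_n := edge_adj (edges G).

(* Vertex sets are always {0, ..., n-1}, so there are finitely many graphs of
   each order, and a set of graphs closed under isomorphism is infinite iff it
   contains infinitely many isomorphism classes. *)
Definition graph : Type := {n : nat & sgraph n}.

Definition as_graph (n : nat) (G : sgraph n) : graph := existT sgraph n G.

Definition isomorphic (G H : graph) : Prop :=
  exists2 f : 'I_(tag G) -> 'I_(tag H),
    bijective f & forall u v, adj (tagged H) (f u) (f v) = adj (tagged G) u v.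

Definition iso_closed (Pi : set graph) : Prop :=
  forall G H, isomorphic G H -> Pi G -> Pi H.

Definition degree (n : nat) (G : sgraph n) (u : 'I_n) : nat := #|adj G u|.

Definition bounded_deg (d : nat) (n : nat) (G : sgraph n) : Prop :=
  forall u, (degree G u <= d)%N.

Definition graph_property (d : nat) (Pi : set graph) : Prop :=
  iso_closed Pi /\ forall G, Pi G -> bounded_deg d (tagged G).

Definition subproperty (P Pi : set graph) : Prop := P `<=` Pi /\ iso_closed P.

Definition complement (d : nat) (Pi : set graph) : set graph :=
  [set G | bounded_deg d (tagged G) /\ ~ Pi G].

Definition slice (Pi : set graph) (n : nat) : set (sgraph n) :=
  [set G | Pi (as_graph G)].

(* The least number of edge insertions and deletions turning G into H. *)
Definition edit_dist (n : nat) (G H : sgraph n) : nat :=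
  (#|edges G :\: edges H| + #|edges H :\: edges G|)%N.

(* If no graph of order n is in Pi, then every graph of order n is far. *)
Definition far (R : realType) (d : nat) (eps : R) (Pi : set graph) (n : nat)
    (G : sgraph n) : Prop :=
  forall H, slice Pi H -> eps * d%:R * n%:R < (edit_dist G H)%:R.

Definition oracle (n d : nat) : Type := 'I_n -> 'I_d -> option 'I_n.

(* The neighbours of a vertex may be listed in any order; [onth] answers [None]
   past the end of the list. *)
Definition represents (n d : nat) (G : sgraph n) (O : oracle n d) : Prop :=
  exists2 N : 'I_n -> seq 'I_n,
    forall u, perm_eq (N u) (enum (adj G u)) & forall u i, O u i = onth (N u) i.

(* A deterministic adaptive algorithm with input size n: it stops with a
   verdict, or makes a query and continues depending on the answer. *)
Inductive strategy (n d : nat) : Type :=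
| Verdict (accept : bool)
| Query (u : 'I_n) (i : 'I_d) (k : option 'I_n -> strategy n d).

Fixpoint accepts (n d : nat) (t : strategy n d) (O : oracle n d) : bool :=
  match t with
  | Verdict b => b
  | Query u i k => accepts (k (O u i)) O
  end.

Fixpoint queries (n d : nat) (t : strategy n d) (O : oracle n d) : nat :=
  match t with
  | Verdict _ => 0%N
  | Query u i k => (queries (k (O u i)) O).+1
  end.

(* A randomized algorithm is a random choice of a deterministic one.  A finite
   sample space is no restriction: there are finitely many oracles of given
   n and d, so strategies have finitely many behaviours on them. *)
Record rand_algo (R : realType) (n d : nat) := RandAlgo {
  coins : finType;
  weight : coins -> R;
  weight_ge0 : forall w, 0 <= weight w;
  weight_sum1 : \sum_w weight w = 1;
  run : coins -> strategy n d }.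

Arguments weight {R n d} r _.
Arguments run {R n d} r _.

Definition pr_accept (R : realType) (n d : nat) (A : rand_algo R n d)
    (O : oracle n d) : R :=
  \sum_(w | accepts (run A w) O) weight A w.

Definition pr_reject (R : realType) (n d : nat) (A : rand_algo R n d)
    (O : oracle n d) : R :=
  \sum_(w | ~~ accepts (run A w) O) weight A w.

Definition tester (R : realType) (d : nat) (Pi : set graph)
    (T : R -> forall n : nat, rand_algo R n d) : Prop :=
  forall (eps : R) (n : nat) (G : sgraph n) (O : oracle n d),
    0 < eps <= 1 -> bounded_deg d G -> represents G O ->
    (slice Pi G -> 2 / 3 <= pr_accept (T eps n) O) /\
    (far d eps Pi G -> 2 / 3 <= pr_reject (T eps n) O).

Definition query_bounded (R : realType) (d : nat)
    (T : R -> forall n : nat, rand_algo R n d) (q : R -> nat) : Prop :=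
  forall (eps : R) (n : nat) (G : sgraph n) (O : oracle n d),
    0 < eps <= 1 -> bounded_deg d G -> represents G O ->
    forall w : coins (T eps n), (queries (run (T eps n) w) O <= q eps)%N.

Definition testable (R : realType) (d : nat) (Pi : set graph) : Prop :=
  exists (T : R -> forall n : nat, rand_algo R n d) (q : R -> nat),
    tester Pi T /\ query_bounded T q.

Definition far_graphs (R : realType) (d : nat) (eps : R) (Pi : set graph) :
    set graph :=
  [set G | bounded_deg d (tagged G) /\ far d eps Pi (tagged G)].

Definition nontrivially_testable (R : realType) (d : nat) (Pi : set graph) :
    Prop :=
  testable R d Pi /\
  exists2 eps : R, 0 < eps & infinite_set (far_graphs d eps Pi).

Definition hyperfinite_at (R : realType) (d : nat) (eps : R) (k : nat)
    (n : nat) (G : sgraph n) : Prop :=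
  exists F : {set {set 'I_n}},
    [/\ F \subset edges G, (#|F|)%:R <= eps * d%:R * n%:R &
        forall u, (#|connect (edge_adj (edges G :\: F)) u| <= k)%N].

Definition rho_hyperfinite (R : realType) (d : nat) (rho : R -> nat) (n : nat)
    (G : sgraph n) : Prop :=
  forall eps : R, 0 < eps -> hyperfinite_at d eps (rho eps) G.

Definition hyperfinite (R : realType) (d : nat) (P : set graph) : Prop :=
  exists rho : R -> nat,
    (forall eps : R, 0 < eps -> (0 < rho eps)%N) /\
    (forall G, P G -> rho_hyperfinite d rho (tagged G)).

Definition has_infinite_hyperfinite_subproperty (R : realType) (d : nat)
    (Pi : set graph) : Prop :=
  exists P : set graph,
    [/\ subproperty P Pi, infinite_set P & hyperfinite R d P].

(* Main.v *)
Require Import Defs.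
From mathcomp Require Import all_boot all_order all_algebra.
From mathcomp Require Import boolp classical_sets functions cardinality reals.
From mathcomp Require Import all_fingroup zify lra.

(** A tester making at most q queries only sees the balls of radius q around a
   few random vertices, so on a randomly relabelled graph it behaves almost the
   same on two graphs of order n with nearly the same statistics of q-balls.
   Rounding these statistics gives finitely many profiles, so among unboundedly
   many graphs of a set A, unboundedly many have the same profile as a fixed
   H in A.  Such a G of large order n cannot be told apart from the disjoint
   union C of n / |H| copies of H and a few isolated vertices.

   If A consists of graphs far from Pi, then C is rejected with probability
   more than 1/3, so C is not in Pi, and its components have at most |H| vertices.

   If A is contained in Pi, then C is eps-close to a graph G' of Pi, and G' is
   (eps, |H|)-hyperfinite.  Moreover, since H itself lies in A, any
   (eps', k)-hyperfiniteness shared by all of A is inherited by C, hence by G' at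
   the cost of replacing eps' with eps' + eps.  Iterating with eps = 2^-(j+1)
   yields, for every j, unboundedly many graphs in Pi that are
   (2^-i, k_i)-hyperfinite for all i < j, and one graph for each j suffices. *)

Set Implicit Arguments.
Unset Strict Implicit.
Unset Printing Implicit Defensive.

(** * Walks and local types *)
Section Walks.
Variables (n d : nat).
Implicit Types (O : oracle n d) (w v : seq (option 'I_d)).

(* A letter [None] means staying put, so that all words of radius [s] can be
   taken of length exactly [s]. *)
Definition walk_step O (x : option 'I_n) (a : option 'I_d) : option 'I_n :=
  if a is Some i then obind (O^~ i) x else x.

Definition walk O (x : option 'I_n) w : option 'I_n := foldl (walk_step O) x w.

Definition reversible O :=
  forall x i y, O x i = Some y -> exists j, O y j = Some x.

Lemma walk_None O w : walk O None w = None.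
Proof. by elim: w => //= -[i|]. Qed.

Lemma walk_stay O x s : walk O x (nseq s None) = x.
Proof. by elim: s. Qed.

Lemma walk_reverse O x y w : reversible O -> walk O (Some x) w = Some y ->
  exists2 v, size v = size w & walk O (Some y) v = Some x.
Proof.
move=> revO; elim: w x => [|[i|] w IHw] x /=.
- by case=> ->; exists [::].
- rewrite /walk /=; case Exi: (O x i) => [x1|]; last by rewrite -/(walk _ _ _) walk_None.
  move=> /IHw [v sv wv]; have [j Oj] := revO _ _ _ Exi.
  exists (rcons v (Some j)); first by rewrite size_rcons sv.
  by rewrite /walk foldl_rcons -/(walk _ _ _) wv.
- move=> /IHw [v sv wv]; exists (None :: v); rewrite /= ?sv //.
Qed.

(* The pairs of [K] extend to a partial isomorphism between the balls of radius
   [s] around them: this is what a tester with [s] queries left can explore. *)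
Definition matching s O O' (K : seq ('I_n * 'I_n)) :=
  forall p q w v, p \in K -> q \in K -> size w = s -> size v = s ->
    (walk O (Some p.1) w == walk O (Some q.1) v) =
    (walk O' (Some p.2) w == walk O' (Some q.2) v) /\
    (walk O (Some p.1) w == None) = (walk O' (Some p.2) w == None).

Definition word s := s.-tuple (option 'I_d).

(** Recording which words end at the same vertex and which run off the graph describes the rooted,
    port-numbered ball. The type does not depend on [n], so graphs of different orders can be
    compared. *)
Definition ball_type s : finType := ({set word s * word s} * {set word s})%type.

Definition type_of s O (x : 'I_n) : ball_type s :=
  ([set p : word s * word s | walk O (Some x) p.1 == walk O (Some x) p.2],
   [set w : word s | walk O (Some x) w == None]).

Lemma matchingW s O O' K : matching s.+1 O O' K -> matching s O O' K.
Proof.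
move=> mK p q w v pK qK sw sv.
by have := mK p q (None :: w) (None :: v) pK qK; rewrite /= sw sv; apply.
Qed.

Lemma matching_le s r O O' K : s <= r -> matching r O O' K -> matching s O O' K.
Proof.
by move=> /subnK <-; elim: (r - s) => // k IHk /matchingW.
Qed.

Lemma matching_eq s O O' K p q : matching s O O' K -> p \in K -> q \in K ->
  (p.1 == q.1) = (p.2 == q.2).
Proof.
move=> mK pK qK.
have [+ _] := mK p q (nseq s None) (nseq s None) pK qK (size_nseq _ _) (size_nseq _ _).
by rewrite !walk_stay.
Qed.

Lemma matching_None s O O' K p i : matching s.+1 O O' K -> p \in K ->
  (O p.1 i == None) = (O' p.2 i == None).
Proof.
move=> mK pK.
have := mK p p (Some i :: nseq s None) (Some i :: nseq s None) pK pK.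
by rewrite /= size_nseq /walk /= -!/(walk _ _ _) !walk_stay => /(_ erefl erefl)[].
Qed.

(** Every pair of the enlarged list is one letter away from a pair of [K], so words of length [s]
    from it are words of length [s.+1] from [K]. *)
Lemma matching_push s O O' K p i y y' : matching s.+1 O O' K -> p \in K ->
  O p.1 i = Some y -> O' p.2 i = Some y' -> matching s O O' ((y, y') :: K).
Proof.
move=> mK pK Oy Oy'.
have lift_word q : q \in (y, y') :: K -> exists p' a, [/\ p' \in K,
    walk_step O (Some p'.1) a = Some q.1 & walk_step O' (Some p'.2) a = Some q.2].
  by rewrite inE => /orP[/eqP ->|qK]; [exists p, (Some i) | exists q, None].
move=> q1 q2 w v /lift_word[p1 [a1 [p1K e1 e1']]] /lift_word[p2 [a2 [p2K e2 e2']]] sw sv.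
have := mK p1 p2 (a1 :: w) (a2 :: v) p1K p2K.
by rewrite /= sw sv /walk /= e1 e1' e2 e2'; apply.
Qed.

Lemma type_of_matching s O O' z z' : type_of s O z = type_of s O' z' ->
  matching s O O' [:: (z, z')].
Proof.
move=> [/setP e1 /setP e2] p q w v.
rewrite !mem_seq1 => /eqP -> /eqP -> /eqP sw /eqP sv /=.
by have := e1 (Tuple sw, Tuple sv); have := e2 (Tuple sw); rewrite !inE /= => -> ->.
Qed.

Definition near s O (xs : seq 'I_n) : {set 'I_n} :=
  [set z | has (fun x => [exists w : word s, walk O (Some x) w == Some z]) xs].

Lemma card_near s O xs : #|near s O xs| <= size xs * d.+1 ^ s.
Proof.
pose ws : seq ('I_n * word s) := [seq (x, u) | x <- xs, u <- enum {: word s}].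
apply: (@leq_trans #|pmap (fun p : 'I_n * word s => walk O (Some p.1) p.2) ws|).
  apply/subset_leq_card/fintype.subsetP => z; rewrite inE => /hasP[x xxs /existsP[w /eqP ew]].
  rewrite mem_pmap; apply/mapP; exists (x, w) => //.
  by apply/allpairsP; exists (x, w); rewrite mem_enum.
rewrite (leq_trans (card_size _)) // size_pmap (leq_trans (count_size _ _)) //.
by rewrite size_allpairs -cardE card_tuple card_option card_ord.
Qed.

Lemma notin_near s O xs z : z \notin near s O xs -> z \notin xs.
Proof.
apply: contra => zxs; rewrite inE; apply/hasP; exists z => //.
by apply/existsP; exists [tuple of nseq s None]; rewrite walk_stay.
Qed.

(** If the two walks met at a vertex, reversing the second would give a walk of length [s + s] from
    [x] to [z]. *)
Lemma walk_disjoint s O xs x z w v : reversible O -> x \in xs ->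
  size w = s -> size v = s -> z \notin near (s + s) O xs ->
  walk O (Some x) w = walk O (Some z) v -> walk O (Some x) w = None.
Proof.
move=> revO xxs sw sv znear.
case E: (walk O (Some x) w) => [y|//] /esym /(walk_reverse revO)[v' sv' wv'].
case/negP: znear; rewrite inE; apply/hasP; exists x => //; apply/existsP.
have swv : size (w ++ v') == s + s by rewrite size_cat sw sv' sv.
by exists (Tuple swv); rewrite /walk /= foldl_cat -!/(walk _ _ _) E wv'.
Qed.

Lemma matching_root s O O' K z z' : reversible O -> reversible O' ->
  matching s O O' K -> matching s O O' [:: (z, z')] ->
  z \notin near (s + s) O (unzip1 K) -> z' \notin near (s + s) O' (unzip2 K) ->
  matching s O O' ((z, z') :: K).
Proof.
move=> revO revO' mK mz zK zK'.
(* Far roots never meet the explored part, so a mixed equality can only be [None = None], and each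
   of [mK] and [mz] preserves being [None]. *)
have mzK p w v : p \in K -> size w = s -> size v = s ->
    (walk O (Some p.1) w == walk O (Some z) v) = (walk O' (Some p.2) w == walk O' (Some z') v).
  move=> pK sw sv.
  have [_ eN] := mK p p w w pK pK sw sw.
  have [_ ezN] := mz (z, z') (z, z') v v (mem_head _ _) (mem_head _ _) sv sv.
  apply/eqP/eqP => e.
    have wN := walk_disjoint revO (map_f fst pK) sw sv zK e.
    have /eqP-> : walk O' (Some p.2) w == None by rewrite -eN wN.
    by apply/esym/eqP; rewrite -ezN -e wN.
  have wN := walk_disjoint revO' (map_f snd pK) sw sv zK' e.
  have /eqP-> : walk O (Some p.1) w == None by rewrite eN wN.
  by apply/esym/eqP; rewrite ezN -e wN.
move=> p q w v; rewrite !inE => /orP[/eqP->|pK] /orP[/eqP->|qK] sw sv /=.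
- exact: mz (mem_head _ _) (mem_head _ _) sw sv.
- by split; [rewrite eq_sym mzK // eq_sym | 
    have [] := mz (z, z') (z, z') w w (mem_head _ _) (mem_head _ _) sw sw].
- by split; [rewrite mzK | have [] := mK p p w w pK pK sw sw].
- exact: mK.
Qed.
End Walks.

(** * Counting relabellings *)
Section Relabelling.
Variables (n d : nat).
Implicit Types (O : oracle n d) (t : strategy n d) (kappa : seq ('I_n * 'I_n)).

Definition relabel_oracle O (tau : 'S_n) : oracle n d :=
  fun u i => omap (tau^-1)%g (O (tau u) i).

(* Running out of the fuel [s] counts as not returning [b]; the hypothesis on
   queries in [tester] only concerns oracles that represent bounded graphs. *)
Fixpoint returns (b : bool) (s : nat) t O : bool :=
  match t, s with
  | Verdict c, _ => c == b
  | Query u i k, s'.+1 => returns b s' (k (O u i)) O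
  | Query _ _ _, 0 => false
  end.

Lemma returnsE b s t O : queries t O <= s -> returns b s t O = (accepts t O == b).
Proof. by elim: t s => [c|u i k IHk] [|s] //= /IHk. Qed.

(** [tau] sends a label to the vertex it denotes; [kappa] lists the label-vertex pairs revealed so
    far. Counting its extensions replaces conditioning on them. *)
Definition extends kappa : pred 'S_n := fun tau => all (fun p => tau p.1 == p.2) kappa.

Lemma card_split_val (P : pred 'S_n) u :
  #|[set tau | P tau]| = \sum_z #|[set tau : 'S_n | (tau u == z) && P tau]|.
Proof.
rewrite -sum1_card (partition_big (fun tau : 'S_n => tau u) xpredT) //=.
by apply: eq_bigr => z _; rewrite -sum1_card; apply: eq_bigl => tau; rewrite !inE andbC.
Qed.

Lemma card_split_label (P : pred 'S_n) y :
  #|[set tau | P tau]| = \sum_l #|[set tau : 'S_n | (tau l == y) && P tau]|.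
Proof.
rewrite -sum1_card (partition_big (fun tau : 'S_n => (tau^-1)%g y) xpredT) //=.
apply: eq_bigr => l _; rewrite -sum1_card; apply: eq_bigl => tau; rewrite !inE andbC.
congr andb; apply/eqP/eqP => [<-|<-]; by rewrite ?permKV ?permK.
Qed.

(* Composing with the transposition of [z] and [z'] injects one set of
   relabellings into the other. *)
Lemma extends_swap kappa u z z' :
  z \notin unzip2 kappa -> z' \notin unzip2 kappa ->
  #|[set tau | extends ((u, z) :: kappa) tau]| <= #|[set tau | extends ((u, z') :: kappa) tau]|.
Proof.
move=> zK z'K; rewrite -(card_imset _ (@mulIg _ (tperm z z'))).
apply/subset_leq_card/fintype.subsetP => _ /imsetP[tau + ->].
rewrite !inE /= !permM => /andP[/eqP-> etau]; rewrite tpermL eqxx /=.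
apply/allP => p pK; rewrite permM (eqP (allP etau p pK)).
rewrite tpermD //; [apply: contraNneq zK | apply: contraNneq z'K] => ->; exact: map_f.
Qed.

Lemma card_notin (xs : seq 'I_n) : uniq xs ->
  #|(fun i : 'I_n => i \notin xs)| = n - size xs.
Proof.
move=> /card_uniqP sxs; have := cardC (mem xs); rewrite card_ord sxs => e.
by rewrite -(canRL (addKn _) e); exact: eq_card.
Qed.

(** By [extends_swap], all vertices outside [kappa] are equally frequent images of a fresh label, so
    each new pair divides the count by the number of such vertices. *)
Lemma card_extends kappa : uniq (unzip1 kappa) -> uniq (unzip2 kappa) ->
  #|[set tau | extends kappa tau]| = (n - size kappa)`!.
Proof.
elim: kappa => [_ _|[u z] kappa IHk].
  rewrite subn0 -card_Sn; apply: eq_card => tau; by rewrite !inE.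
rewrite /= => /andP[uK uniq1] /andP[zK uniq2].
have lt_kn : size kappa < n.
  have := uniq_leq_size (s1 := z :: unzip2 kappa) (s2 := enum 'I_n).
  rewrite /= zK uniq2 size_enum_ord size_map; apply=> // x _; exact: mem_enum.
move: (IHk uniq1 uniq2); rewrite (card_split_val _ u).
have -> : n - size kappa = (n - (size kappa).+1).+1 by lia.
rewrite factS (bigID (mem (unzip2 kappa))) /= big1 ?add0n => [|x xK].
  rewrite (eq_bigr (fun=> #|[set tau | extends ((u, z) :: kappa) tau]|)) => [|x xK].
    rewrite sum_nat_const => H; apply/eqP; rewrite -(eqn_pmul2l (ltn0Sn (n - (size kappa).+1))).
    rewrite -H; apply/eqP; congr (_ * _).
    rewrite card_notin // size_map; lia.
  by apply/eqP; rewrite eqn_leq !extends_swap.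
apply: eq_card0 => tau; rewrite !inE; apply/negbTE/negP => /andP[/eqP tx etau].
case/mapP: xK => p pK ex; have /eqP := allP etau p pK; rewrite -ex -tx => /perm_inj ep.
by case/negP: uK; rewrite -ep map_f.
Qed.

Lemma card_extends_dup kappa (P : pred 'S_n) u z :
  z \in unzip2 kappa -> u \notin unzip1 kappa ->
  #|[set tau | extends ((u, z) :: kappa) tau & P tau]| = 0.
Proof.
move=> zK uK; apply: eq_card0 => tau; rewrite !inE; apply/negbTE/negP.
rewrite /= => /andP[/andP[/eqP tx etau] _].
case/mapP: zK => p pK ex; have /eqP := allP etau p pK; rewrite -ex -tx => /perm_inj ep.
by case/negP: uK; rewrite -ep map_f.
Qed.

Lemma card_extends_dup_label kappa (P : pred 'S_n) l y :
  l \in unzip1 kappa -> y \notin unzip2 kappa ->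
  #|[set tau | extends ((l, y) :: kappa) tau & P tau]| = 0.
Proof.
move=> lK yK; apply: eq_card0 => tau; rewrite !inE; apply/negbTE/negP.
rewrite /= => /andP[/andP[/eqP tx etau] _].
case/mapP: lK => p pK ex; have /eqP := allP etau p pK; rewrite -ex tx => ep.
by case/negP: yK; rewrite ep map_f.
Qed.

(** For [kappa] without repetitions, division by the factorial of [n - size kappa] gives the
    probability that [t] returns [b] within [s] queries under a uniform relabelling extending
    [kappa]. *)
Definition count_returns b s O kappa t : nat :=
  #|[set tau | extends kappa tau & returns b s t (relabel_oracle O tau)]|.

Lemma count_returns_le b s O kappa t : uniq (unzip1 kappa) -> uniq (unzip2 kappa) ->
  count_returns b s O kappa t <= (n - size kappa)`!.
Proof.
move=> u1 u2; rewrite -card_extends //; apply/subset_leq_card/fintype.subsetP => tau.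
by rewrite !inE => /andP[].
Qed.

Lemma count_returns_verdict b s O kappa a : uniq (unzip1 kappa) -> uniq (unzip2 kappa) ->
  count_returns b s O kappa (Verdict n d a) = (a == b) * (n - size kappa)`!.
Proof.
move=> u1 u2; case ab: (a == b); last first.
  by apply: eq_card0 => tau; rewrite !inE; case: s => [|s] /=; rewrite ab andbF.
rewrite mul1n -card_extends //; apply: eq_card => tau; rewrite !inE.
by case: s => [|s] /=; rewrite ab andbT.
Qed.

Lemma count_returns_split_val b s O kappa t u :
  count_returns b s O kappa t = \sum_z count_returns b s O ((u, z) :: kappa) t.
Proof.
rewrite /count_returns (card_split_val _ u); apply: eq_bigr => z _.
by apply: eq_card => tau; rewrite !inE andbA.
Qed.

Lemma count_returns_split_label b s O kappa t y :
  count_returns b s O kappa t = \sum_l count_returns b s O ((l, y) :: kappa) t.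
Proof.
rewrite /count_returns (card_split_label _ y); apply: eq_bigr => z _.
by apply: eq_card => tau; rewrite !inE andbA.
Qed.

Lemma count_returns_query b s O kappa u i k x a : (u, x) \in kappa ->
  (forall tau, extends kappa tau -> omap (tau^-1)%g (O x i) = a) ->
  count_returns b s.+1 O kappa (Query u i k) = count_returns b s O kappa (k a).
Proof.
move=> uxK ea; apply: eq_card => tau; rewrite !inE; apply: andb_id2l => etau /=.
by rewrite /relabel_oracle (eqP (allP etau _ uxK)) /= ea.
Qed.
End Relabelling.

(** * Locally similar oracles give similar acceptance counts *)
Section Indistinguishable.
Variables (n d q D c : nat) (O O' : oracle n d) (phi : 'S_n) (b : bool).
Hypotheses (revO : reversible O) (revO' : reversible O').
Hypothesis few_mismatches :
  #|[set z | type_of q O z != type_of q O' (phi z)]| <= c.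
(** Here [c] counts mismatches, and the next summand bounds, for both graphs together, the vertices
    within distance [q + q] of at most [2 * q] known ones. The last [2 * q] makes room for the
    labels already used. *)
Hypothesis n_large : D * (c + 4 * q * d.+1 ^ (q + q)) + 2 * q <= n.

Implicit Types (K : seq ('I_n * ('I_n * 'I_n))) (t : strategy n d).

Definition left_pair (p : 'I_n * ('I_n * 'I_n)) := (p.1, p.2.1).
Definition right_pair (p : 'I_n * ('I_n * 'I_n)) := (p.1, p.2.2).
Definition on_left K := [seq left_pair p | p <- K].
Definition on_right K := [seq right_pair p | p <- K].

Lemma on_left1 K : unzip1 (on_left K) = unzip1 K.
Proof. by rewrite /unzip1 -map_comp. Qed.
Lemma on_right1 K : unzip1 (on_right K) = unzip1 K.
Proof. by rewrite /unzip1 -map_comp. Qed.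
Lemma on_left2 K : unzip2 (on_left K) = unzip1 (unzip2 K).
Proof. by rewrite /unzip1 /unzip2 -!map_comp. Qed.
Lemma on_right2 K : unzip2 (on_right K) = unzip2 (unzip2 K).
Proof. by rewrite /unzip2 -!map_comp. Qed.

(* A state lists the labels seen so far, each with the vertices it denotes in
   the two graphs. *)
Definition coupled s K := [/\ uniq (unzip1 K), uniq (unzip1 (unzip2 K)),
  uniq (unzip2 (unzip2 K)) & matching s O O' (unzip2 K)].

(** In terms of probabilities, each remaining query costs at most [1 / D]. Multiplying by [D] keeps
    the estimate in the natural numbers. *)
Definition close_counts s t K :=
  D * count_returns b s O (on_left K) t <=
  D * count_returns b s O' (on_right K) t + s * (n - size K)`!.

Lemma sum_fresh (xs : seq 'I_n) (F : 'I_n -> nat) a : uniq xs -> size xs < n ->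
  (forall x, x \notin xs -> F x <= a * (n - (size xs).+1)`!) ->
  (forall x, x \in xs -> F x = 0) ->
  \sum_x F x <= a * (n - size xs)`!.
Proof.
move=> uxs ltn leF eF; rewrite (bigID (mem xs)) /= big1 // add0n.
rewrite (leq_trans (leq_sum _ (fun x Hx => leF x Hx))) // sum_nat_const.
rewrite card_notin //; have -> : n - size xs = (n - (size xs).+1).+1 by lia.
by rewrite factS [leqRHS]mulnCA.
Qed.

(** At a known label the answers correspond by [matching], so the coupling cannot fail and the error
    keeps the factor [s]. The strict inequality leaves room in [K] for one fresh answer. *)
Lemma close_known s u i k K :
  (forall t K', coupled s K' -> 2 * s + size K' <= 2 * q -> close_counts s t K') ->
  coupled s.+1 K -> 2 * s + size K < 2 * q -> u \in unzip1 K ->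
  D * count_returns b s.+1 O (on_left K) (Query u i k) <=
  D * count_returns b s.+1 O' (on_right K) (Query u i k) + s * (n - size K)`!.
Proof.
move=> IH [uK uK1 uK2 mK] sK /mapP[[u' [x x']] uxK /= eu]; subst u'.
have sK' : 2 * s + size K <= 2 * q by lia.
have cK : coupled s K by split => //; exact: matchingW.
have uxL : (u, x) \in on_left K by exact: (map_f left_pair uxK).
have uxR : (u, x') \in on_right K by exact: (map_f right_pair uxK).
have xxK : (x, x') \in unzip2 K by exact: (map_f snd uxK).
have := matching_None i mK xxK => /=.
case Ox: (O x i) => [y|]; case Ox': (O' x' i) => [y'|] //= _; last first.
  rewrite (@count_returns_query _ _ _ _ _ _ _ _ _ _ None uxL) => [|tau _]; last by rewrite Ox.
  rewrite (@count_returns_query _ _ _ _ _ _ _ _ _ _ None uxR) => [|tau _]; last by rewrite Ox'.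
  exact: IH.
have myK := matching_push mK xxK Ox Ox'.
have eyy p : p \in unzip2 K -> (p.1 == y) = (p.2 == y').
  by move=> pK; apply: (matching_eq myK (q := (y, y'))); rewrite inE ?pK ?orbT ?eqxx.
(* An answer already seen comes from the same entry of [K] on both sides, so both runs continue with
   the same label [l]. *)
have [|yK] := boolP (y \in unzip1 (unzip2 K)).
  move=> /mapP[[y1 y2] /[dup] y2K /mapP[[l [y3 y4]] lK [e1 e2]] /= ey].
  subst y3 y4 y1.
  have ey' : y2 = y' by apply/eqP; rewrite -(eyy _ y2K).
  rewrite (@count_returns_query _ _ _ _ _ _ _ _ _ _ (Some l) uxL) => [|tau etau]; last first.
    rewrite Ox /=.
    have /(allP etau)/= /eqP <- : (l, y) \in on_left K by exact: (map_f left_pair lK).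
    by rewrite permK.
  rewrite (@count_returns_query _ _ _ _ _ _ _ _ _ _ (Some l) uxR) => [|tau etau]; last first.
    have /(allP etau)/= /eqP : (l, y2) \in on_right K by exact: (map_f right_pair lK).
    by rewrite Ox' ey' /= => <-; rewrite permK.
  exact: IH.
have y'K : y' \notin unzip2 (unzip2 K).
  apply: contra yK => /mapP[p pK /eqP]; rewrite eq_sym -eyy // => /eqP <-.
  exact: map_f.
rewrite (count_returns_split_label _ _ _ _ _ y).
rewrite (count_returns_split_label _ _ _ (on_right K) _ y').
have lt_Kn : size K < n by lia.
rewrite !big_distrr /=.
pose F1 l := D * count_returns b s.+1 O ((l, y) :: on_left K) (Query u i k).
pose F2 l := D * count_returns b s.+1 O' ((l, y') :: on_right K) (Query u i k).
(* Subtraction truncates at zero, so the sum of the branchwise excesses bounds the difference of the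
   sums. *)
have leF : \sum_l (F1 l - F2 l) <= s * (n - size (unzip1 K))`!.
  apply: sum_fresh => //; rewrite ?size_map // => l lK; rewrite /F1 /F2.
    rewrite leq_subLR (@count_returns_query _ _ _ _ _ _ _ _ _ x (Some l)); first last.
    - by move=> tau /andP[/eqP /= tl _]; rewrite Ox /= -tl permK.
    - by rewrite inE uxL orbT.
    rewrite (@count_returns_query _ _ _ _ _ _ _ _ _ x' (Some l)); first last.
    - by move=> tau /andP[/eqP /= tl _]; rewrite Ox' /= -tl permK.
    - by rewrite inE uxR orbT.
    have := IH (k (Some l)) ((l, (y, y')) :: K); rewrite /close_counts /=; apply; last lia.
    by split; rewrite /= ?lK ?yK ?y'K.
  by rewrite /F1 /count_returns card_extends_dup_label ?on_left1 ?on_left2 // muln0.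
rewrite size_map in leF; apply: leq_trans (leq_add (leqnn _) leF).
by rewrite -big_split leq_sum // => l _; rewrite -leq_subLR.
Qed.

(* A query at an unseen label reveals a uniformly random fresh vertex [z], coupled
   with [phi z]; the coupling fails only on the few bad [z], each of which
   accounts for at most [(n - size K - 1)!] relabellings. *)
Lemma counts_close s t K : s <= q -> coupled s K -> 2 * s + size K <= 2 * q ->
  close_counts s t K.
Proof.
elim: s t K => [|s IHs] [a|u i k] K leq cK szK; rewrite /close_counts.
- case: cK => uK uK1 uK2 _.
  rewrite !count_returns_verdict ?on_left1 ?on_left2 ?on_right1 ?on_right2 //.
  by rewrite !size_map leq_addr.
- by rewrite /count_returns eq_card0 ?muln0 // => tau; rewrite !inE andbF.
- case: cK => uK uK1 uK2 _.
  rewrite !count_returns_verdict ?on_left1 ?on_left2 ?on_right1 ?on_right2 //.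
  by rewrite !size_map leq_addr.
have IH t K' : coupled s K' -> 2 * s + size K' <= 2 * q -> close_counts s t K'.
  by apply: IHs; lia.
have [uinK|uK] := boolP (u \in unzip1 K).
  have lt : 2 * s + size K < 2 * q by lia.
  apply: leq_trans (close_known i k IH cK lt uinK) _; rewrite leq_add2l leq_mul2r.
  by rewrite leqnSn orbT.
have [uK1 uKl uKr mK] := cK.
rewrite (count_returns_split_val _ _ _ _ _ u) (count_returns_split_val _ _ _ (on_right K) _ u).
rewrite [X in _ <= _ * X + _](reindex_inj (@perm_inj _ phi)) /= !big_distrr /=.
pose F1 z := D * count_returns b s.+1 O ((u, z) :: on_left K) (Query u i k).
pose F2 z := D * count_returns b s.+1 O' ((u, phi z) :: on_right K) (Query u i k).
pose W := (2 * q) * d.+1 ^ (q + q).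
pose bad := [set z | type_of q O z != type_of q O' (phi z)]
  :|: (near (s.+1 + s.+1) O (unzip1 (unzip2 K))
       :|: phi @^-1: near (s.+1 + s.+1) O' (unzip2 (unzip2 K))).
pose f := (n - (size K).+1)`!.
have card_bad : #|bad| <= c + (W + W).
  rewrite (leq_trans (leq_card_setU _ _)) // leq_add // (leq_trans (leq_card_setU _ _)) //.
  have leW (X : oracle n d) xs : size xs = size K -> #|near (s.+1 + s.+1) X xs| <= W.
    move=> sxs; apply: leq_trans (card_near _ _ _) _; rewrite sxs leq_mul //; first lia.
    by rewrite leq_pexp2l //; lia.
  rewrite leq_add ?leW ?size_map //.
  by rewrite card_preimset ?leW ?size_map //; exact: perm_inj.
have leF : \sum_z (F1 z - F2 z - (z \in bad) * (D * f)) <= s * (n - size (unzip1 (unzip2 K)))`!.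
  apply: sum_fresh => //; rewrite ?size_map //; first lia.
    move=> z zK; have [zbad|zbad] := boolP (z \in bad).
      rewrite mul1n (_ : _ - _ = 0) //; apply/eqP; rewrite subn_eq0 (leq_trans (leq_subr _ _)) //.
      rewrite leq_mul2l; apply/orP; right; apply: leq_trans (count_returns_le _ _ _ _ _ _) _.
      - by rewrite /= on_left1 uK uK1.
      - by rewrite /= on_left2 zK uKl.
      - by rewrite /= size_map.
    rewrite mul0n subn0 leq_subLR.
    move: zbad; rewrite 2!finset.in_setU !negb_or finset.in_set negbK.
    rewrite [z \in _ @^-1: _]inE => /and3P[/eqP ety znear z'near].
    have zl : z \notin unzip1 (unzip2 K) := notin_near znear.
    have zr : phi z \notin unzip2 (unzip2 K) := notin_near z'near.
    have lt : 2 * s + size ((u, (z, phi z)) :: K) < 2 * q by rewrite /=; lia.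
    have cK' : coupled s.+1 ((u, (z, phi z)) :: K).
      split; rewrite /= ?uK ?zl ?zr //.
      by apply: matching_root => //; apply: matching_le leq (type_of_matching ety).
    (* With [u] revealed as [z] and [phi z], the query is at a known label and contributes only the
       factor [s]. *)
    have := close_known i k IH cK' lt (mem_head _ _).
    by apply.
  move=> z zK; rewrite /F1 /count_returns card_extends_dup ?on_left1 ?on_left2 ?muln0 //.
rewrite !size_map in leF.
have sum_bad : \sum_z (z \in bad) * (D * f) = #|bad| * (D * f).
  rewrite -big_distrl /=; congr (_ * _); rewrite -sum1_card [RHS]big_mkcond /=.
  by apply: eq_bigr => z _; case: (z \in bad).
(* By [n_large], all bad vertices together cost one unit: the difference between [s] and [s.+1] in
   the error. *)
have le_bad : #|bad| * (D * f) <= (n - size K)`!.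
  have -> : n - size K = (n - (size K).+1).+1 by lia.
  rewrite factS mulnA leq_mul2r; apply/orP; right.
  apply: leq_trans (leq_mul card_bad (leqnn D)) _; rewrite /W; nia.
have le_split z : F1 z <=
    F2 z + ((z \in bad) * (D * f) + (F1 z - F2 z - (z \in bad) * (D * f))) by lia.
apply: leq_trans (leq_sum _ (fun z _ => le_split z)) _.
by rewrite !big_split /= leq_add2l mulSn leq_add // sum_bad.
Qed.
End Indistinguishable.

(** * Relabelling graphs *)
(* A permutation with fewest mismatches never has a bad [x] and a bad [y] with
   [f x = g (phi y)], since swapping their images would improve it. *)
Lemma exists_aligning_perm (n : nat) (T : finType) (f g : 'I_n -> T) :
  exists phi : 'S_n, #|[set z | f z != g (phi z)]| <=
    \sum_t (#|[set z | f z == t]| - #|[set z | g z == t]|).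
Proof.
pose bad (phi : 'S_n) := [set z | f z != g (phi z)].
case: (@arg_minnP _ (1%g : 'S_n) xpredT (fun phi => #|bad phi|) isT) => phi _ phi_min.
exists phi; rewrite -/(bad phi) -sum1_card (partition_big f xpredT) //=.
apply: leq_sum => t _; rewrite sum1_card.
rewrite (_ : #|_| = #|[set z in bad phi | f z == t]|); last first.
  by apply: eq_card => z; rewrite unfold_in !inE.
have [->|[x]] := set_0Vmem [set z in bad phi | f z == t]; first by rewrite cards0.
rewrite !inE => /andP[xbad /eqP fx].
have good y : g (phi y) = t -> f y = t.
  move=> gy; apply: contra_eq (esym gy) => fy.
  have ybad : y \in bad phi by rewrite inE gy.
  apply: contraTneq (phi_min (tperm x y * phi)%g isT) => _; rewrite -ltnNge.
  apply/proper_card/properP; split; last first.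
    by exists x; rewrite inE // negbK permM tpermL fx gy.
  apply/fintype.subsetP => z; rewrite !inE permM; case: tpermP => [->|-> _|_ _ //].
    by rewrite fx gy eqxx.
  by rewrite gy.
(* By [good], the vertices with [g (phi z) = t] lie in the class [f z = t]; its bad vertices are
   disjoint from them, hence no more than the surplus. *)
have -> : #|[set z | g z == t]| = #|[set z | g (phi z) == t]|.
  by rewrite -[LHS](card_preimset _ (@perm_inj _ phi)); apply: eq_card => z; rewrite !inE.
rewrite leq_subRL; last first.
  by apply/subset_leq_card/fintype.subsetP => z; rewrite !inE => /eqP /good ->; rewrite eqxx.
rewrite -cardsUI (_ : _ :&: _ = finset.set0) ?cards0 ?addn0; last first.
  apply/setP => z; rewrite !inE; apply/negbTE/negP => /andP[/eqP gz /andP[/negP fg _]].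
  by apply: fg; rewrite gz good.
apply/subset_leq_card/fintype.subsetP => z; rewrite !inE => /orP[/eqP /good -> //|/andP[]//].
Qed.

Section Graphs.
Variable n : nat.
Implicit Types (G : sgraph n) (e : rel 'I_n).

Lemma adj_sym G : symmetric (adj G).
Proof. by move=> u v; rewrite /adj /edge_adj finset.setUC. Qed.

Lemma edgesP G E :
  reflect (exists u v, adj G u v /\ E = [set u; v]) (E \in edges G).
Proof.
apply: (iffP idP) => [EG|[u [v [uv ->]]]]; last exact: uv.
have /cards2P[u [v [_ eE]]] := forall_inP (edges_card2 G) E EG.
by exists u, v; split; rewrite /adj /edge_adj -?eE.
Qed.

Lemma adj_irr G : irreflexive (adj G).
Proof.
move=> u; apply/negbTE/negP => uu.
by have := forall_inP (edges_card2 G) _ uu; rewrite finset.setUid cards1.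
Qed.

Definition rel_edges e : {set {set 'I_n}} :=
  [set E | [exists u, [exists v, [&& u != v, e u v & E == [set u; v]]]]].

Lemma rel_edges_card2 e : [forall E in rel_edges e, #|E| == 2].
Proof.
apply/forall_inP => E; rewrite inE => /existsP[u /existsP[v /and3P[uv _ /eqP->]]].
by rewrite cards2 uv.
Qed.

Definition rel_graph e : sgraph n := SGraph (rel_edges_card2 e).

Lemma adj_rel_graph e : symmetric e -> irreflexive e -> adj (rel_graph e) =2 e.
Proof.
move=> syme irre u v; rewrite /adj /edge_adj inE.
apply/existsP/idP => [[x /existsP[y /and3P[xy exy /eqP E]]]|uv].
  have card_uv : #|[set u; v]| = 2 by rewrite E cards2 xy.
  have : u \in [set x; y] by rewrite -E finset.set21.
  have : v \in [set x; y] by rewrite -E finset.set22.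
  case/set2P => ev; case/set2P => eu; move: card_uv; rewrite eu ev // ?cards2 ?eqxx //.
  by rewrite syme.
exists u; apply/existsP; exists v; rewrite uv eqxx /= andbT.
by apply: contraTneq uv => ->; rewrite irre.
Qed.

Definition relabel (tau : 'S_n) G : sgraph n :=
  rel_graph (fun u v => adj G (tau u) (tau v)).

Lemma adj_relabel tau G u v : adj (relabel tau G) u v = adj G (tau u) (tau v).
Proof.
by rewrite adj_rel_graph // => [x y|x]; rewrite ?adj_irr 1?adj_sym.
Qed.

Lemma graph_ext G H : adj G =2 adj H -> G = H.
Proof.
move=> eGH; apply: val_inj; apply/setP => E.
by apply/edgesP/edgesP => -[u [v [uv ->]]]; exists u, v; rewrite ?eGH // -eGH.
Qed.

Lemma edges_relabel tau G E : (E \in edges (relabel tau G)) = (tau @: E \in edges G).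
Proof.
apply/edgesP/edgesP => -[u [v [uv eE]]].
  by exists (tau u), (tau v); rewrite -adj_relabel eE imsetU !imset_set1.
exists ((tau^-1)%g u), ((tau^-1)%g v); rewrite adj_relabel !permKV; split=> //.
apply: (imset_inj (@perm_inj _ tau)); rewrite eE imsetU !imset_set1.
by rewrite !permKV.
Qed.

Lemma edit_dist_relabel tau G H : edit_dist (relabel tau G) (relabel tau H) = edit_dist G H.
Proof.
have inj : injective (fun E : {set 'I_n} => tau @: E) by apply: imset_inj; exact: perm_inj.
congr addn; rewrite -[RHS](card_preimset _ inj); apply: eq_card => E;
  by rewrite [RHS]inE !finset.in_setD !edges_relabel.
Qed.

Lemma relabelK tau G : relabel (tau^-1)%g (relabel tau G) = G.
Proof. by apply: graph_ext => u v; rewrite !adj_relabel !permKV. Qed.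

Lemma isomorphic_relabel tau G : isomorphic (as_graph G) (as_graph (relabel tau G)).
Proof.
exists (tau^-1)%g => [|u v]; first exact: injF_bij (@perm_inj _ _).
by rewrite /= adj_relabel !permKV.
Qed.

Lemma isomorphic_relabelV tau G : isomorphic (as_graph (relabel tau G)) (as_graph G).
Proof. by exists tau => [|u v]; [exact: injF_bij (@perm_inj _ _) | rewrite /= adj_relabel]. Qed.

Lemma slice_relabel (Pi : set graph) tau G : iso_closed Pi ->
  slice Pi (relabel tau G) <-> slice Pi G.
Proof.
move=> isoPi; split; apply: isoPi; [exact: isomorphic_relabelV | exact: isomorphic_relabel].
Qed.

Lemma far_relabel (R : realType) d (eps : R) (Pi : set graph) tau G : iso_closed Pi ->
  far d eps Pi (relabel tau G) <-> far d eps Pi G.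
Proof.
move=> isoPi; split=> farG H HPi.
  by rewrite -(edit_dist_relabel tau); apply: farG; apply/slice_relabel.
rewrite -(edit_dist_relabel (tau^-1)%g) relabelK; apply: farG.
exact/slice_relabel.
Qed.

Lemma bounded_deg_relabel d tau G : bounded_deg d G -> bounded_deg d (relabel tau G).
Proof.
move=> dG u; apply: leq_trans (dG (tau u)).
rewrite /degree -(fintype.card_image (@perm_inj _ tau)).
apply/subset_leq_card/fintype.subsetP => v.
by case/fintype.imageP => w; rewrite /in_mem /= adj_relabel => ? ->.
Qed.

(** * Oracles representing a graph *)

Section Oracles.
Variables (d : nat).

Lemma represents_adj G (O : oracle n d) u i v : represents G O -> O u i = Some v -> adj G u v.
Proof.
case=> N pN -> e; have : v \in N u.
  by apply/onthP; exists i.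
by rewrite (perm_mem (pN u)) mem_enum.
Qed.

(** The degree bound puts the position of [x] in the list of [y] below [d], so it is a legal
    query. *)
Lemma represents_reversible G (O : oracle n d) :
  bounded_deg d G -> represents G O -> reversible O.
Proof.
move=> dG rO x i y /(represents_adj rO); rewrite adj_sym => yx.
case: rO => N pN eO; have xN : x \in N y by rewrite (perm_mem (pN y)) mem_enum.
have lt : index x (N y) < d.
  by apply: leq_trans (dG y); rewrite /degree cardE -(perm_size (pN y)) index_mem.
by exists (Ordinal lt); rewrite eO onthE (nth_map x) ?index_mem //= nth_index.
Qed.

Lemma represents_relabel G (O : oracle n d) tau :
  represents G O -> represents (relabel tau G) (relabel_oracle O tau).
Proof.
case=> N pN eO; exists (fun u => map (tau^-1)%g (N (tau u))) => [u|u i].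
  apply: uniq_perm; rewrite ?enum_uniq //.
    by rewrite map_inj_uniq ?(perm_uniq (pN _)) ?enum_uniq //; exact: perm_inj.
  move=> v; rewrite mem_enum -{1}(permK tau v) mem_map; last exact: perm_inj.
  by rewrite (perm_mem (pN _)) mem_enum /in_mem /= adj_relabel.
by rewrite /relabel_oracle eO onth_map.
Qed.
End Oracles.
End Graphs.

(** * Disjoint copies of a small graph *)
Section Copies.
Variables (m n : nat) (m_gt0 : 0 < m) (H : sgraph m).

Definition residue (u : 'I_n) : 'I_m := Ordinal (ltn_pmod u m_gt0).

(** Copies occupy consecutive blocks of [m] vertices; the last [n %% m] vertices fill no block and
    stay isolated. *)
Definition in_copy (u : 'I_n) : bool := u %/ m < n %/ m.

(* The copy of [y] in the block of [u]; junk unless [in_copy u]. *)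
Definition sibling (u : 'I_n) (y : 'I_m) : 'I_n := insubd u (u %/ m * m + y).

Definition copies : sgraph n :=
  rel_graph (fun u v => [&& u %/ m == v %/ m, in_copy u & adj H (residue u) (residue v)]).

Lemma adj_copies u v : adj copies u v =
  [&& u %/ m == v %/ m, in_copy u & adj H (residue u) (residue v)].
Proof.
rewrite adj_rel_graph // => [x y|x]; last by rewrite adj_irr !andbF.
by rewrite eq_sym adj_sym /in_copy; case: eqP => [->|].
Qed.

Lemma block_lt b (y : 'I_m) : b < n %/ m -> b * m + y < n.
Proof. move=> lt; have := leq_trunc_div n m; have := ltn_ord y; nia. Qed.

Lemma val_sibling u y : in_copy u -> sibling u y = u %/ m * m + y :> nat.
Proof. by move=> cu; rewrite val_insubd block_lt. Qed.

Lemma sibling_div u y : in_copy u -> sibling u y %/ m = u %/ m.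
Proof. by move=> cu; rewrite val_sibling // divnMDl // (divn_small (ltn_ord y)) addn0. Qed.

Lemma residue_sibling u y : in_copy u -> residue (sibling u y) = y.
Proof. by move=> cu; apply: val_inj; rewrite /= val_sibling // modnMDl modn_small. Qed.

Lemma in_copy_sibling u y : in_copy u -> in_copy (sibling u y).
Proof. by move=> cu; rewrite /in_copy sibling_div. Qed.

Lemma sibling_residue (u v : 'I_n) : u %/ m = v %/ m -> in_copy u -> sibling u (residue v) = v.
Proof. by move=> e cu; apply: val_inj; rewrite /= val_sibling // e -divn_eq. Qed.

Lemma sibling_sibling u y z : in_copy u -> sibling (sibling u y) z = sibling u z.
Proof.
by move=> cu; apply: ord_inj; rewrite val_sibling ?in_copy_sibling // sibling_div // val_sibling.
Qed.

Lemma sibling_inj u : in_copy u -> injective (sibling u).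
Proof. by move=> cu; apply: can_inj (fun y => residue_sibling y cu). Qed.

Variables (d : nat) (O : oracle m d).

Definition copies_oracle : oracle n d :=
  fun u i => if in_copy u then omap (sibling u) (O (residue u) i) else None.

Lemma represents_copies : represents H O -> represents copies copies_oracle.
Proof.
case=> N pN eO; exists (fun u => if in_copy u then map (sibling u) (N (residue u)) else [::]).
  move=> u; apply: uniq_perm; rewrite ?enum_uniq //.
    by case: ifP => // cu; rewrite (map_inj_uniq (sibling_inj cu)) (perm_uniq (pN _)) enum_uniq.
  move=> v; rewrite mem_enum /in_mem /= adj_copies.
  case cu: (in_copy u) => /=; last by rewrite andbF.
  apply/mapP/andP => [[y yN ->]|[/eqP euv uv]].
    by move: yN; rewrite (perm_mem (pN _)) mem_enum sibling_div // residue_sibling // eqxx.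
  exists (residue v); last by rewrite sibling_residue.
  by rewrite (perm_mem (pN _)) mem_enum.
move=> u i; rewrite /copies_oracle; case: ifP => cu; last by rewrite onth0n.
by rewrite eO onth_map.
Qed.

Lemma bounded_deg_copies : bounded_deg d H -> bounded_deg d copies.
Proof.
move=> dH u; case cu: (in_copy u); last first.
  rewrite /degree eq_card0 // => v; by rewrite /in_mem /= adj_copies cu andbF.
apply: leq_trans (dH (residue u)); rewrite /degree -(fintype.card_image (sibling_inj cu)).
apply/subset_leq_card/fintype.subsetP => v; rewrite {1}/in_mem /= adj_copies => /and3P[/eqP e _ a].
by apply/fintype.imageP; exists (residue v) => //; rewrite sibling_residue.
Qed.

Lemma walk_copies u y w : in_copy u ->
  walk copies_oracle (Some (sibling u y)) w = omap (sibling u) (walk O (Some y) w).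
Proof.
move=> cu; elim: w y => [|[i|] w IHw] y //=.
rewrite /walk /= /copies_oracle in_copy_sibling // residue_sibling //.
case: (O y i) => [z|] /=; last by rewrite -!/(walk _ _ _) !walk_None.
by rewrite sibling_sibling //; exact: IHw.
Qed.

Lemma type_of_copies s u : in_copy u ->
  type_of s copies_oracle u = type_of s O (residue u).
Proof.
move=> cu; rewrite /type_of -{1 2 3}(sibling_residue erefl cu).
congr pair; apply/setP => p; rewrite !inE !walk_copies //.
  by rewrite (inj_eq (inj_omap (sibling_inj cu))).
by case: (walk _ _ _).
Qed.

(** Only a lower bound, since leftover vertices may also have type [theta]. *)
Lemma card_type_copies s (theta : ball_type d s) :
  n %/ m * #|[set y | type_of s O y == theta]| <=
  #|[set u | type_of s copies_oracle u == theta]|.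
Proof.
pose f (p : 'I_(n %/ m) * 'I_m) : 'I_n := Ordinal (block_lt p.2 (ltn_ord p.1)).
have divf p : f p %/ m = p.1 by rewrite /= divnMDl // (divn_small (ltn_ord p.2)) addn0.
have resf p : residue (f p) = p.2 by apply: val_inj; rewrite /= modnMDl modn_small.
have injf : injective f.
  move=> p q e; rewrite [p]surjective_pairing [q]surjective_pairing; congr pair.
    by apply: ord_inj; rewrite -!divf e.
  by rewrite -!resf e.
rewrite -{1}(card_ord (n %/ m)) -cardsT -cardsX -(card_imset _ injf).
apply/subset_leq_card/fintype.subsetP => _ /imsetP[p + ->].
by rewrite !inE /= => /eqP <-; rewrite type_of_copies ?resf // /in_copy divf.
Qed.
End Copies.

(** * Profiles and pigeonhole *)
Import Order.TTheory GRing.Theory Num.Theory.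

(** The same as infinite, as each order has finitely many graphs; this form supplies members of
    large order directly. *)
Definition unbounded (A : set graph) : Prop :=
  forall N, exists2 G, A G & N < tag G.

Lemma unbounded_pigeonhole (T : finType) (c : graph -> T) (A : set graph) :
  unbounded A -> exists t, unbounded (fun G => A G /\ c G = t).
Proof.
move=> unbA; apply: contrapT => /forallNP bndA.
have /choice[N leN] t : exists N, forall G, A G -> c G = t -> tag G <= N.
  move: (bndA t) => /existsNP[N bndN]; exists N => G AG cG.
  by rewrite leqNgt; apply/negP => lt; apply: bndN; exists G.
have [G AG] := unbA (\max_t N t); apply/negP; rewrite -leqNgt.
exact: leq_trans (leN _ _ AG erefl) (leq_bigmax _).
Qed.

Lemma unbounded_infinite (A : set graph) : unbounded A -> infinite_set A.
Proof.
move=> unbA /finite_seqP[s As].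
have [G] := unbA (\max_(G <- s) tag G); rewrite As => Gs; apply/negP; rewrite -leqNgt.
exact: leq_bigmax_seq.
Qed.

Lemma infinite_unbounded (A : set graph) : infinite_set A -> unbounded A.
Proof.
move=> infA N; apply: contrapT => bnd; apply: infA.
apply: (@sub_finite_set _ _ (\bigcup_(n in `I_N.+1) range (@as_graph n))).
  move=> [n G] AG; exists n => /=; last by exists G.
  by rewrite ltnS leqNgt; apply/negP => lt; apply: bnd; exists (existT _ n G).
apply: bigcup_finite => [|n _]; first exact: finite_II.
apply: finite_image; exact: finite_finset.
Qed.

Section Profiles.
Variable d : nat.

Definition list_oracle n (G : sgraph n) : oracle n d :=
  fun u i => onth (enum (adj G u)) i.

Lemma represents_list_oracle n (G : sgraph n) : represents G (list_oracle G).
Proof. by exists (fun u => enum (adj G u)). Qed.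

Definition type_count q n (O : oracle n d) (t : ball_type d q) : nat :=
  #|[set x | type_of q O x == t]|.
Arguments type_count q {n} O t.

(* Frequencies of the types, rounded down to multiples of [1 / D]. *)
Definition profile q D (G : graph) : {ffun ball_type d q -> 'I_D.+1} :=
  [ffun t => inord (D * type_count q (list_oracle (tagged G)) t %/ tag G)].

Lemma type_count_le q n (O : oracle n d) (t : ball_type d q) : type_count q O t <= n.
Proof. by rewrite -[leqRHS]card_ord max_card. Qed.

(** Rounding to multiples of [1 / D] costs [tag G]; the fewer than [tag H] leftover vertices cost
    [D * tag H]. *)
Lemma same_profile q D (G H : graph) (m_gt0 : 0 < tag H) t :
  0 < tag G -> profile q D G = profile q D H ->
  D * type_count q (list_oracle (tagged G)) t <=
  D * type_count q (copies_oracle (n := tag G) m_gt0 (list_oracle (tagged H))) t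
    + tag G + D * tag H.
Proof.
move=> n_gt0 /ffunP/(_ t)/(congr1 (@nat_of_ord _)); rewrite !ffunE.
have leD n (O : oracle n d) : 0 < n -> D * type_count q O t %/ n < D.+1.
  by move=> gt0; rewrite ltnS -[leqRHS](mulnK D gt0) leq_div2r // leq_mul2l type_count_le orbT.
rewrite !inordK ?leD // => e.
have : tag G %/ tag H * type_count q (list_oracle (tagged H)) t <=
    type_count q (copies_oracle (n := tag G) m_gt0 (list_oracle (tagged H))) t.
  exact: card_type_copies.
have := type_count_le (list_oracle (tagged H)) t.
have := divn_eq (tag G) (tag H); have := ltn_pmod (tag G) m_gt0.
have := leq_trunc_div (D * type_count q (list_oracle (tagged H)) t) (tag H).
have := ltn_ceil (D * type_count q (list_oracle (tagged G)) t) n_gt0.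
rewrite e.
set cG := type_count _ _ _; set cC := type_count q (copies_oracle _ _) _.
set cH := type_count q (list_oracle (tagged H)) _.
set a := (D * cH) %/ _; set k := tag G %/ tag H; set r := tag G %% tag H.
move: cG cH cC a k r => cG cH cC a k r.
move: (tag G) (tag H) => n m h1 h2 h3 h4 h5 h6.
have : D * (k * cH) <= D * cC by rewrite leq_mul2l h6 orbT.
have : r * a <= m * a by rewrite leq_mul2r (ltnW h3) orbT.
have : D * cH <= D * m by rewrite leq_mul2l h5 orbT.
have : k * (a * m) <= k * (D * cH) by rewrite leq_mul2l h2 orbT.
nia.
Qed.
(** Under a uniform relabelling, the chance of returning [b] within [q] queries drops by at most 1/4
    from [O] to [O'], less than the gap between 2/3 and 1/3. *)
Definition indistinguishable q n (O O' : oracle n d) :=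
  forall b t, 4 * count_returns b q O [::] t <= 4 * count_returns b q O' [::] t + n`!.

Lemma copies_indistinguishable q (A : set graph) : unbounded A ->
  (forall G, A G -> bounded_deg d (tagged G)) ->
  exists (H : graph) (m_gt0 : 0 < tag H), A H /\ forall N, exists G, [/\ A G, N < tag G &
    indistinguishable q (list_oracle (tagged G))
      (copies_oracle (n := tag G) m_gt0 (list_oracle (tagged H)))].
Proof.
move=> unbA dA.
(* A run of [q] queries loses at most [q / D0 < 1 / 4]. Each of the [T] types loses [tag G / D] to
   rounding, in total [tag G / (2 * D0)], half of what [n_large] allows. *)
pose T := #|ball_type d q|; pose D0 := 4 * q.+1; pose D := 2 * D0 * T.
have T_gt0 : 0 < T by apply/card_gt0P; exists (finset.set0, finset.set0).
have [theta unbAt] := unbounded_pigeonhole (profile q D) unbA.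
have [H [AH pH] m_gt0] := unbAt 0; exists H, m_gt0; split=> // N.
pose W := 4 * q * d.+1 ^ (q + q).
(* The other terms of [n_large] do not depend on [G], so a large order absorbs them. *)
have [G [AG pG] ltG] := unbAt (N + (D * tag H + 2 * (D0 * W + 2 * q))).
exists G; split=> //; first lia.
set O := list_oracle _; set O' := copies_oracle _ _.
have revO : reversible O := represents_reversible (dA _ AG) (represents_list_oracle _).
have revO' : reversible O'.
  apply: (represents_reversible (G := copies (tag G) m_gt0 (tagged H))).
    exact/bounded_deg_copies/dA.
  exact/represents_copies/represents_list_oracle.
have [phi] := exists_aligning_perm (type_of q O) (type_of q O').
set c := \sum_t _ => le_c.
have Dc : D * c <= T * (tag G + D * tag H).
  rewrite /T -sum_nat_const big_distrr /=; apply: leq_sum => t _.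
  rewrite mulnBr leq_subLR addnA.
  by apply: same_profile; [lia | rewrite pG pH].
have D0c : 2 * (D0 * c) <= tag G + D * tag H.
  by rewrite -(leq_pmul2l T_gt0) (leq_trans _ Dc) // /D; nia.
have n_large : D0 * (c + 4 * q * d.+1 ^ (q + q)) + 2 * q <= tag G.
  by rewrite mulnDr -/W; lia.
move=> b t.
have := counts_close b revO revO' le_c n_large t (s := q) (K := [::]) (leqnn q).
rewrite /close_counts /= subn0 /D0 => close.
have {}close : 4 * q.+1 * count_returns b q O [::] t <=
    4 * q.+1 * count_returns b q O' [::] t + q * (tag G)`!.
  by apply: close; rewrite ?addn0 //; split=> // p r w v; rewrite in_nil.
rewrite -(leq_pmul2l (ltn0Sn q)) mulnDr; move: close; rewrite mulSn; lia.
Qed.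
End Profiles.

(** * From counts of relabellings to probabilities *)

Section Transfer.
Variables (R : realType) (n d q : nat).
Implicit Types (A : rand_algo R n d) (O : oracle n d).
Local Open Scope ring_scope.

Definition pr_return b A O : R :=
  \sum_(w | accepts (run A w) O == b) weight A w.

Lemma pr_return_true A O : pr_return true A O = pr_accept A O.
Proof. by apply: eq_bigl => w; rewrite eqb_id. Qed.

Lemma pr_return_false A O : pr_return false A O = pr_reject A O.
Proof. by apply: eq_bigl => w; rewrite eqbF_neg. Qed.

Lemma pr_accept_reject A O : pr_accept A O + pr_reject A O = 1.
Proof. by rewrite -(weight_sum1 A) [RHS](bigID (fun w => accepts (run A w) O)). Qed.

Lemma sum_pr_return b A O :
  (forall tau w, queries (run A w) (relabel_oracle O tau) <= q)%N ->
  \sum_(tau : 'S_n) pr_return b A (relabel_oracle O tau) =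
  \sum_w weight A w * (count_returns b q O [::] (run A w))%:R.
Proof.
move=> leq; under eq_bigr do rewrite /pr_return big_mkcond /=.
rewrite exchange_big /=; apply: eq_bigr => w _.
rewrite -big_mkcond sumr_const /= mulr_natr; congr (_ *+ _).
by apply: eq_card => tau; rewrite !inE /= returnsE.
Qed.

(** Average over all relabellings: the mean for [O] is at least 2/3, so the mean for [O'] is at
    least 2/3 - 1/4, which exceeds 1/3. *)
Lemma indistinguishable_pr b A O O' :
  (forall tau w, queries (run A w) (relabel_oracle O tau) <= q)%N ->
  (forall tau w, queries (run A w) (relabel_oracle O' tau) <= q)%N ->
  indistinguishable q O O' ->
  (forall tau, 2 / 3 <= pr_return b A (relabel_oracle O tau)) ->
  exists tau, 1 / 3 < pr_return b A (relabel_oracle O' tau).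
Proof.
move=> qO qO' close ge23; apply: contrapT => /forallNP le13.
have cardS : #|'S_n| = n`! by rewrite -card_Sn; apply: eq_card => tau; rewrite !inE.
have ge : 2 / 3 * n`!%:R <= \sum_w weight A w * (count_returns b q O [::] (run A w))%:R.
  rewrite -sum_pr_return // [leLHS]mulr_natr -cardS -sumr_const.
  by apply: ler_sum => tau _; exact: ge23.
have le : \sum_w weight A w * (count_returns b q O' [::] (run A w))%:R <= 1 / 3 * n`!%:R.
  rewrite -sum_pr_return // [leRHS]mulr_natr -cardS -sumr_const.
  by apply: ler_sum => tau _; rewrite leNgt; apply/negP/le13.
have : 4 * \sum_w weight A w * (count_returns b q O [::] (run A w))%:R <=
    4 * (\sum_w weight A w * (count_returns b q O' [::] (run A w))%:R) + n`!%:R.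
  have -> : n`!%:R = \sum_w weight A w * n`!%:R by rewrite -mulr_suml weight_sum1 mul1r.
  rewrite !mulr_sumr -big_split /=.
  apply: ler_sum => w _; rewrite mulrCA [X in _ <= X + _]mulrCA -mulrDr.
  rewrite ler_wpM2l ?weight_ge0 //.
  by have := close b (run A w); rewrite -(ler_nat R) natrD !natrM.
have : 0 < n`!%:R :> R by rewrite ltr0n fact_gt0.
lra.
Qed.
End Transfer.

(** * Hyperfiniteness through vertex colourings *)
Definition monochromatic n (T : finType) (c : 'I_n -> T) (E : {set 'I_n}) : bool :=
  [forall u in E, forall v in E, c u == c v].

Lemma monochromatic2 n (T : finType) (c : 'I_n -> T) u v :
  monochromatic c [set u; v] = (c u == c v).
Proof.
apply/forall_inP/eqP => [mono|e x].
  by apply/eqP; apply: (forall_inP (mono u (finset.set21 _ _))); exact: finset.set22.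
by case/set2P => ->; apply/forall_inP => y /set2P[] ->; rewrite ?e.
Qed.

Definition cut n (T : finType) (c : 'I_n -> T) (G : sgraph n) : {set {set 'I_n}} :=
  [set E in edges G | ~~ monochromatic c E].

Section Hyperfinite.
Variables (R : realType) (d : nat).
Local Open Scope ring_scope.

(** Components become colours; conversely, paths of uncut edges stay within one colour. Colour
    classes need not be connected, which makes colourings easy to transport to other graphs. *)
Lemma hyperfiniteP (eps : R) k n (G : sgraph n) : hyperfinite_at d eps k G <->
  exists (T : finType) (c : 'I_n -> T),
    (forall u, #|[set v | c v == c u]|%SET <= k)%N /\
    #|cut c G|%:R <= eps * d%:R * n%:R.
Proof.
split=> [[F [FG cardF leF]]|[T [c [lec cardc]]]].
  pose e := edge_adj (edges G :\: F).
  have sym_e : connect_sym e.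
    by apply: sym_connect_sym => u v; rewrite /e /edge_adj finset.setUC.
  exists {set 'I_n}, (fun u => [set v | connect e u v]%SET); split=> [u|].
    apply: leq_trans (leF u); apply/subset_leq_card/fintype.subsetP => v.
    rewrite inE => /eqP/setP/(_ v); rewrite !inE connect0 => /esym.
    by rewrite /in_mem.
  apply: le_trans cardF; rewrite ler_nat; apply/subset_leq_card/fintype.subsetP => E.
  rewrite inE => /andP[EG]; apply: contraR => EF.
  have /edgesP[u [v [uv eE]]] := EG; rewrite eE monochromatic2.
  apply/eqP/setP => w; rewrite !inE; apply: same_connect => //.
  by apply: connect1; rewrite /e /edge_adj -eE finset.in_setD EF.
exists (cut c G); split=> //; first by apply/fintype.subsetP => E; rewrite inE => /andP[].
move=> u; apply: leq_trans (lec u); apply/subset_leq_card/fintype.subsetP => v.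
move=> uv; rewrite inE; 
have {uv}/connectP[p] : connect (edge_adj (edges G :\: cut c G)) u v := uv.
elim: p u => [|x p IHp] u /=; first by move=> _ ->.
move=> /andP[ux px] ev; rewrite (eqP (IHp x px ev)) eq_sym -monochromatic2.
move: ux; rewrite /edge_adj finset.in_setD inE.
by case: (_ \in edges G); rewrite ?andbT ?andbF //= negbK.
Qed.

Lemma hyperfinite_atW (eps eps' : R) k k' n (G : sgraph n) :
  eps <= eps' -> (k <= k')%N -> hyperfinite_at d eps k G -> hyperfinite_at d eps' k' G.
Proof.
move=> le_eps le_k [F [FG cardF leF]]; exists F; split=> //.
  by apply: le_trans cardF _; rewrite !ler_wpM2r.
by move=> u; apply: leq_trans (leF u) _.
Qed.

Lemma hyperfinite_at_order (eps : R) k n (G : sgraph n) :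
  0 <= eps -> (n <= k)%N -> hyperfinite_at d eps k G.
Proof.
move=> eps_ge0 le_nk; exists finset.set0; rewrite finset.sub0set cards0; split=> //.
  by rewrite !mulr_ge0.
by move=> u; apply: leq_trans le_nk; rewrite -[leqRHS]card_ord max_card.
Qed.

Lemma isomorphic_sym G H : isomorphic G H -> isomorphic H G.
Proof.
case=> f [g fK gK] adjf; exists g; first by exists f.
by move=> u v; rewrite -adjf !gK.
Qed.

Lemma isomorphic_order G H : isomorphic G H -> tag G = tag H.
Proof. by case=> f bijf _; have := bij_eq_card bijf; rewrite !card_ord. Qed.

Lemma bounded_deg_iso G H :
  isomorphic G H -> bounded_deg d (tagged G) -> bounded_deg d (tagged H).
Proof.
move=> /isomorphic_sym[f bijf adjf] dG u; apply: leq_trans (dG (f u)).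
have injf := bij_inj bijf.
rewrite /degree -(fintype.card_image injf); apply/subset_leq_card/fintype.subsetP => v.
by case/fintype.imageP => w; rewrite /in_mem /= => uw ->; rewrite adjf.
Qed.

Lemma hyperfinite_at_iso (eps : R) k G H : isomorphic G H ->
  hyperfinite_at d eps k (tagged G) -> hyperfinite_at d eps k (tagged H).
Proof.
move=> isoGH /hyperfiniteP[T [c [lec cardc]]]; apply/hyperfiniteP.
have eGH := isomorphic_order isoGH; case/isomorphic_sym: isoGH => f bijf adjf.
have injf := bij_inj bijf.
exists T, (c \o f); split=> [u|].
  apply: leq_trans (lec (f u)); rewrite -(card_imset _ injf).
  apply/subset_leq_card/fintype.subsetP => v.
  by case/imsetP => w; rewrite !inE /= => ? ->.
apply: (@le_trans _ _ (eps * d%:R * (tag G)%:R)); last by rewrite eGH.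
apply: le_trans cardc; rewrite ler_nat -(card_imset _ (imset_inj injf)).
apply/subset_leq_card/fintype.subsetP => _ /imsetP[E + ->].
rewrite inE => /andP[/edgesP[u [v [uv ->]]]].
rewrite monochromatic2 imsetU !imset_set1 inE monochromatic2 => -> /=; rewrite andbT.
by apply/edgesP; exists (f u), (f v); rewrite adjf.
Qed.

(** * Graphs close to disjoint copies *)

Section NearCopies.
Variables (m n : nat) (m_gt0 : (0 < m)%N) (H : sgraph m).
Variables (T : finType) (c : 'I_m -> T).

(** The block number separates the copies, and each leftover vertex is a class of its own. Block
    numbers are at most [n], so [inord] is exact. *)
Definition copies_coloring (u : 'I_n) : ('I_n.+1 * T) + 'I_n :=
  if in_copy m u then inl (inord (u %/ m), c (residue m_gt0 u)) else inr u.

Lemma copies_coloring_eq u v : in_copy m u -> copies_coloring v = copies_coloring u ->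
  [/\ in_copy m v, (v %/ m = u %/ m)%N & c (residue m_gt0 v) = c (residue m_gt0 u)].
Proof.
rewrite /copies_coloring => -> ; case: ifP => // cv [/(congr1 (@nat_of_ord _)) + ->].
have le (w : 'I_n) : (w %/ m < n.+1)%N.
  by rewrite ltnS (leq_trans (leq_div _ _)) // ltnW.
by rewrite !inordK.
Qed.

Lemma copies_coloring_class k u : (forall x, #|[set y | c y == c x]%SET| <= k)%N ->
  (#|[set v | copies_coloring v == copies_coloring u]%SET| <= k)%N.
Proof.
move=> lec; have [cu|cu] := boolP (in_copy m u).
  apply: leq_trans (lec (residue m_gt0 u)).
  rewrite -(card_imset _ (sibling_inj m_gt0 cu)); apply/subset_leq_card/fintype.subsetP => v.
  rewrite inE => /eqP /(copies_coloring_eq cu)[cv e ec].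
  apply/imsetP; exists (residue m_gt0 v); first by rewrite inE ec.
  by rewrite sibling_residue.
apply: leq_trans (lec (residue m_gt0 u)); apply: (@leq_trans 1); last first.
  by apply/card_gt0P; exists (residue m_gt0 u); rewrite inE.
rewrite -(cards1 u); apply/subset_leq_card/fintype.subsetP => v; rewrite !inE.
by rewrite /copies_coloring (negbTE cu); case: ifP => // _ /eqP[->].
Qed.

Lemma card_cut_copies :
  (#|cut copies_coloring (copies n m_gt0 H)| <= n %/ m * #|cut c H|)%N.
Proof.
pose f (p : 'I_(n %/ m) * {set 'I_m}) : {set 'I_n} :=
  (fun y : 'I_m => Ordinal (block_lt m_gt0 y (ltn_ord p.1))) @: p.2.
rewrite -{1}(card_ord (n %/ m)) -cardsT -cardsX; apply: leq_trans (leq_imset_card f _).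
apply/subset_leq_card/fintype.subsetP => E; rewrite inE => /andP[/edgesP[u [v [uv ->]]]].
rewrite monochromatic2; move: uv; rewrite adj_copies => /and3P[/eqP euv cu uv] cuv.
apply/imsetP; exists (Ordinal (cu : u %/ m < n %/ m)%N, [set residue m_gt0 u; residue m_gt0 v]).
  rewrite finset.in_setX finset.in_setT inE monochromatic2 /=; apply/andP; split; first exact: uv.
  apply: contraNneq cuv => e.
  by rewrite /copies_coloring /in_copy -euv -/(in_copy m u) cu e.
rewrite /f imsetU !imset_set1; congr (_ :|: _); congr [set _]; apply: ord_inj => /=.
  by rewrite -divn_eq.
by rewrite euv -divn_eq.
Qed.
End NearCopies.

(** An edge of [G] cut by the colouring of the copies is either a cut edge of the copies or an
    inserted edge, and the edit distance bounds the latter. *)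
Lemma hyperfinite_at_near_copies (eps eps' : R) k m n (m_gt0 : (0 < m)%N)
    (H : sgraph m) (G : sgraph n) :
  hyperfinite_at d eps k H ->
  (edit_dist (copies n m_gt0 H) G)%:R <= eps' * d%:R * n%:R ->
  hyperfinite_at d (eps + eps') k G.
Proof.
move=> /hyperfiniteP[T [c [lec cardc]]] distG; apply/hyperfiniteP.
exists _, (copies_coloring (n := n) m_gt0 c); split=> [u|]; first exact: copies_coloring_class.
set C := copies n m_gt0 H in distG *; set c' := copies_coloring _ _.
have le_cut : (#|cut c' G| <= n %/ m * #|cut c H| + edit_dist C G)%N.
  apply: leq_trans (leq_add (card_cut_copies n m_gt0 H c) (leqnn _)).
  apply: (@leq_trans #|cut c' C :|: (edges G :\: edges C)|%SET).
    apply/subset_leq_card/fintype.subsetP => E; rewrite !inE => /andP[-> ->].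
    by rewrite !andbT orbN.
  by rewrite (leq_trans (leq_card_setU _ _)) // leq_add2l leq_addl.
(* Read off from [cardc], whose left side is a cardinality; it lets [(n %/ m) * m] be replaced by
   [n]. *)
have eps_ge0 : 0 <= eps * d%:R.
  have m_gt0R : 0 < m%:R :> R by rewrite ltr0n.
  by rewrite -(pmulr_lge0 _ m_gt0R) (le_trans _ cardc).
have le_blocks : ((n %/ m) * m)%:R <= n%:R :> R by rewrite ler_nat leq_trunc_div.
have : (#|cut c' G|%:R : R) <= (n %/ m)%:R * #|cut c H|%:R + (edit_dist C G)%:R.
  by rewrite -natrM -natrD ler_nat.
move=> /le_trans; apply; rewrite !mulrDl lerD //.
apply: (@le_trans _ _ ((n %/ m)%:R * (eps * d%:R * m%:R))); first by rewrite ler_wpM2l.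
by rewrite mulrCA -natrM ler_wpM2l.
Qed.

Lemma hyperfinite_subproperty (rho : R -> nat) (X : set graph) : iso_closed X ->
  (forall eps, 0 < eps -> (0 < rho eps)%N) ->
  unbounded (fun G => X G /\ rho_hyperfinite d rho (tagged G)) ->
  has_infinite_hyperfinite_subproperty R d X.
Proof.
move=> isoX rho_gt0 unb; exists (fun G => X G /\ rho_hyperfinite d rho (tagged G)); split.
- split=> [G [] //|G H isoGH [XG hfG]]; split; first exact: isoX isoGH XG.
  by move=> eps eps_gt0; apply: hyperfinite_at_iso isoGH _; exact: hfG.
- exact: unbounded_infinite.
- by exists rho; split=> // G [].
Qed.
End Hyperfinite.

(** * Testable properties *)
Section Main.
Variables (R : realType) (d : nat).
Local Open Scope ring_scope.

(** [b] is the verdict that the tester favours on [A]. Some relabelling of the copies gets [b] with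
    probability above 1/3, so the opposite verdict cannot have probability 2/3 there. *)
Lemma testable_copies (Pi A : set graph) (eps : R) (b : bool) :
  iso_closed Pi -> testable R d Pi -> 0 < eps <= 1 -> unbounded A ->
  (forall G, A G -> bounded_deg d (tagged G)) ->
  (forall G, A G -> if b then slice Pi (tagged G) else far d eps Pi (tagged G)) ->
  exists (H : graph) (m_gt0 : (0 < tag H)%N), A H /\ forall N, exists2 n, (N < n)%N &
    let C := copies n m_gt0 (tagged H) in
    if b then ~ far d eps Pi C else ~ slice Pi C.
Proof.
move=> isoPi [T [q [testT queryT]]] eps01 unbA dA bA.
have [H [m_gt0 [AH manyG]]] := copies_indistinguishable (q eps) unbA dA.
exists H, m_gt0; split=> // N; have [G [AG ltG]] := manyG N.
pose C := copies (tag G) m_gt0 (tagged H); set O := list_oracle _; set O' := copies_oracle _ _.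
move=> /indistinguishable_pr indist; exists (tag G) => //; rewrite -/C /=.
have dC : bounded_deg d C by apply: bounded_deg_copies; exact: dA.
have repO tau : represents (relabel tau (tagged G)) (relabel_oracle O tau).
  exact/represents_relabel/represents_list_oracle.
have repO' tau : represents (relabel tau C) (relabel_oracle O' tau).
  exact/represents_relabel/represents_copies/represents_list_oracle.
have dG' tau : bounded_deg d (relabel tau (tagged G)) by exact/bounded_deg_relabel/dA.
have dC' tau : bounded_deg d (relabel tau C) by exact/bounded_deg_relabel.
have prG tau : 2 / 3 <= pr_return b (T eps (tag G)) (relabel_oracle O tau).
  have [accG rejG] := testT _ _ _ _ eps01 (dG' tau) (repO tau).
  have := bA G AG; case: (b) => AbG.
    by rewrite pr_return_true accG //; apply/slice_relabel.
  by rewrite pr_return_false rejG //; apply/far_relabel.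
have [tau] := indist _ _ _ (fun tau => queryT _ _ _ _ eps01 (dG' tau) (repO tau))
  (fun tau => queryT _ _ _ _ eps01 (dC' tau) (repO' tau)) prG.
have [accC rejC] := testT _ _ _ _ eps01 (dC' tau) (repO' tau).
have := pr_accept_reject (T eps (tag G)) (relabel_oracle O' tau).
case: b {indist bA prG}; rewrite ?pr_return_true ?pr_return_false => sum1 gt13 bad.
  by have := rejC ((far_relabel d eps tau C isoPi).2 bad); lra.
by have := accC ((slice_relabel tau C isoPi).2 bad); lra.
Qed.

(* The slack [2^-size ks] pays for all later approximations, whose errors are
   [2^-(j+1)] for [j >= size ks]. *)
Definition hyperfinite_up_to (Pi : set graph) (ks : seq nat) : set graph :=
  fun G => Pi G /\ forall i, (i < size ks)%N ->
    hyperfinite_at d (2^-1 ^+ i - 2^-1 ^+ size ks : R) (nth 0%N ks i) (tagged G).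

Lemma hyperfinite_up_to_rcons (Pi : set graph) ks :
  graph_property d Pi -> testable R d Pi -> unbounded (hyperfinite_up_to Pi ks) ->
  exists k, unbounded (hyperfinite_up_to Pi (rcons ks k)).
Proof.
move=> [isoPi dPi] testPi unb.
set e := (2^-1 : R) ^+ size ks; pose eps := e / 2.
have e01 : 0 < e <= 1 by rewrite exprn_gt0 ?exprn_ile1 //; lra.
have eps01 : 0 < eps <= 1 by rewrite /eps; lra.
have [||H [m_gt0 [[PiH hfH] many]]] := testable_copies (b := true) isoPi testPi eps01 unb.
- by move=> G [/dPi].
- by move=> [n G] [].
exists (tag H) => N; have [n ltNn] := many N.
move=> /existsNP[G /not_implyP[PiG /negP]]; rewrite -leNgt => distG.
exists (as_graph G) => //; split=> // i; rewrite size_rcons ltnS nth_rcons exprS -/e.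
have ee : 2^-1 * e = eps by rewrite mulrC.
rewrite leq_eqVlt ee => /orP[/eqP ->|lti].
  (* New entry: [H] has only [tag H] vertices and needs no removal, so the whole budget
     [e - eps = eps] pays for the distance to the copies. *)
  rewrite ltnn eqxx -/e (_ : e - eps = 0 + eps); last by rewrite /eps; lra.
  apply: hyperfinite_at_near_copies distG.
  exact: hyperfinite_at_order.
(* Old entries: passing from [H] to [G] costs [eps], exactly the drop of the slack from [e] to
   [e / 2]. *)
rewrite lti (_ : _ - _ = (2^-1 ^+ i - e) + eps); last by rewrite /eps; lra.
by apply: hyperfinite_at_near_copies distG; exact: hfH.
Qed.

Lemma testable_hyperfinite_subproperty (Pi : set graph) :
  graph_property d Pi -> testable R d Pi -> unbounded Pi ->
  has_infinite_hyperfinite_subproperty R d Pi.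
Proof.
move=> propPi testPi unbPi; have [isoPi dPi] := propPi.
(* The junk value 0 makes [f] total, so that iterating it from the empty list yields one infinite
   sequence of bounds. *)
have /choice[f fP] ks : exists k, unbounded (hyperfinite_up_to Pi ks) ->
    unbounded (hyperfinite_up_to Pi (rcons ks k)).
  have [unb|nunb] := pselect (unbounded (hyperfinite_up_to Pi ks)); last by exists 0%N.
  by have [k] := hyperfinite_up_to_rcons propPi testPi unb; exists k.
pose ks j := iter j (fun ks => rcons ks (f ks)) [::].
have size_ks j : size (ks j) = j by elim: j => //= j IHj; rewrite size_rcons IHj.
have unb_ks j : unbounded (hyperfinite_up_to Pi (ks j)).
  elim: j => [|j IHj]; last exact: fP.
  by move=> N; have [G PiG ltG] := unbPi N; exists G.
have nth_ks i j : (i < j)%N -> nth 0%N (ks j) i = f (ks i).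
  elim: j => // j IHj; rewrite ltnS leq_eqVlt /= nth_rcons size_ks => /orP[/eqP ->|lt].
    by rewrite ltnn eqxx.
  by rewrite lt IHj.
(* Diagonal choice: [G j] meets the first [j] bounds, so each bound holds for all but finitely many
   [G j]. *)
have /choice[G GP] j : exists G, hyperfinite_up_to Pi (ks j) G /\ (j < tag G)%N.
  by have [G hG ltG] := unb_ks j j; exists G.
have /choice[lev levP] (eps : R) : exists i, 0 < eps -> (2^-1 : R) ^+ i <= eps.
  have [eps_gt0|] := ltP 0 eps; last by exists 0%N.
  exists (Num.bound eps^-1) => _.
  by rewrite exprVn invf_ple ?posrE ?exprn_gt0 // ltW // upper_nthrootP.
(* Beyond index [lev eps] the bound of that level applies; the finitely many earlier graphs are
   covered by their orders. The 1 ensures positivity. *)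
pose rho eps := maxn 1%N (maxn (f (ks (lev eps))) (\max_(j < (lev eps).+1) tag (G j))).
have rho_gt0 eps : 0 < eps -> (0 < rho eps)%N by rewrite leq_max.
apply: (hyperfinite_subproperty isoPi rho_gt0) => N.
have [[PiG hfG] ltG] := GP N; exists (G N) => //; split=> // eps eps_gt0.
have [leN|ltN] := leqP N (lev eps).
  apply: hyperfinite_at_order; first exact: ltW.
  have ltN1 : (N < (lev eps).+1)%N by [].
  have := leq_bigmax (F := fun j : 'I_(lev eps).+1 => tag (G j)) (Ordinal ltN1).
  by rewrite !leq_max => ->; rewrite !orbT.
have := hfG (lev eps); rewrite size_ks nth_ks // => /(_ ltN).
apply: hyperfinite_atW; last by rewrite !leq_max leqnn orbT.
by rewrite (le_trans _ (levP eps eps_gt0)) // lerBlDr lerDl exprn_ge0 ?invr_ge0.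
Qed.

Lemma nontrivially_testable_complement (Pi : set graph) :
  graph_property d Pi -> nontrivially_testable R d Pi ->
  has_infinite_hyperfinite_subproperty R d (complement d Pi).
Proof.
move=> [isoPi dPi] [testPi [eps eps_gt0 /infinite_unbounded unb]].
(* Testers take parameters at most 1, and lowering [eps] keeps far graphs far. *)
pose eps1 := Num.min eps 1.
have eps01 : 0 < eps1 <= 1 by rewrite lt_min eps_gt0 ltr01 ge_min lexx orbT.
have [||H [m_gt0 [[dH _] many]]] := testable_copies (b := false) isoPi testPi eps01 unb.
- by move=> G [].
- move=> G [_ farG] H /farG; apply: le_lt_trans.
  by rewrite !ler_wpM2r // ge_min lexx.
have isoC : iso_closed (complement d Pi).
  move=> G1 G2 isoG [dG nG]; split; first exact: bounded_deg_iso isoG dG.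
  by move=> PiG2; apply: nG; apply: isoPi PiG2; exact: isomorphic_sym.
(* A constant function suffices: components of the copies have at most [tag H] vertices before any
   removal. *)
apply: (@hyperfinite_subproperty _ _ (fun=> tag H)) => // N.
have [n ltN /= nC] := many N; exists (as_graph (copies n m_gt0 (tagged H))) => //.
split; first by split=> //; exact: bounded_deg_copies.
move=> e e_gt0; rewrite -[e]add0r.
apply: (@hyperfinite_at_near_copies _ _ _ _ _ _ _ m_gt0 (tagged H)).
  exact: hyperfinite_at_order.
rewrite /edit_dist finset.setDv cards0 !mulr_ge0 // ltW //.
Qed.
End Main.

Theorem theorem1p2 (R : realType) (d : nat) (d_ge1 : (1 <= d)%N) :
  (forall Pi : set graph, graph_property d Pi -> testable R d Pi ->
     finite_set Pi \/ has_infinite_hyperfinite_subproperty R d Pi) /\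
  (forall Pi : set graph, graph_property d Pi -> nontrivially_testable R d Pi ->
     has_infinite_hyperfinite_subproperty R d (complement d Pi)).
Proof.
split=> Pi propPi testPi; last exact: nontrivially_testable_complement.
have [finPi|infPi] := pselect (finite_set Pi); [by left | right].
exact/testable_hyperfinite_subproperty/infinite_unbounded.
Qed.
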